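(* Let $a,b\geq 0$ be integers with $a\neq b$, and let $l$ be the minimal index such that $d^a_l\neq d^b_l$. Then $f(a)<f(b)$ if and only if $d^a_l<d^b_l$.
   Context: Let $F_n$ denote the Fibonacci numbers, $F_0=0$, $F_1=1$, $F_n=F_{n-1}+F_{n-2}$ for $n>1$, and let $u_i=F_{2i}$ for $i\geq 1$. Every integer $N\geq 0$ has a unique representation $N=\sum_{i=1}^\infty d_iu_i$ with digits $d_i\in\{0,1,2\}$, only finitely many nonzero, such that whenever $i<j$ and $d_i=d_j=2$ there exists $l$ with $i<l<j$ and $d_l=0$. For $a\geq 0$ write $d^a_i$ for the digits of this representation of $a$, and define $f(a)=\sum_{i=1}^\infty \frac{d^a_i}{u_i}$. *)

(* Defs.v *)
From HB Require Import structures.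
From mathcomp Require Import all_boot all_order all_algebra.
From mathcomp Require Import finmap zify.

Set Implicit Arguments.
Unset Strict Implicit.
Unset Printing Implicit Defensive.

Import Order.TTheory GRing.Theory Num.Theory.

Fixpoint fib (n : nat) : nat :=
  match n with
  | 0 => 0
  | 1 => 1
  | (m.+1 as p).+1 => fib p + fib m
  end.

Definition u (i : nat) : nat := fib i.*2.

(* Digit sequences [d_1, d_2, ...] are finitely supported functions on [nat];
   since indices start at 1, the unused entry [d 0] is required to vanish. *)
Definition digit_seq : Type := {fsfun nat -> nat with 0}.

Definition separated_twos (d : nat -> nat) : Prop :=
  forall i j, i < j -> d i = 2 -> d j = 2 -> exists2 l, i < l < j & d l = 0.

Record represents (d : digit_seq) (N : nat) : Prop := Represents {
  represents0 : d 0 = 0;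
  represents_le2 : forall i, d i <= 2;
  represents_sep : separated_twos d;
  represents_sum : N = \sum_(i <- finsupp d) d i * u i
}.

Lemma uSS n : u n.+2 + u n = 3 * u n.+1.
Proof. by rewrite /u !doubleS /=; lia. Qed.

Lemma u_lt n : u n < u n.+1.
Proof.
elim: n => // n IHn; have := uSS n; lia.
Qed.

Lemma u_gt0 n : 0 < n -> 0 < u n.
Proof. by case: n => // n _; apply: leq_ltn_trans (u_lt n). Qed.

Lemma sum_finsupp (R : nmodType) (d : digit_seq) (n : nat) (F : nat -> R) :
  d 0 = 0 -> (forall i, n < i -> d i = 0) -> (forall i, d i = 0 -> F i = 0%R) ->
  (\sum_(i <- finsupp d) F i = \sum_(1 <= i < n.+1) F i)%R.
Proof.
move=> d0 dn Fd.
rewrite (perm_big [seq i <- index_iota 1 n.+1 | i \in finsupp d]) /=; last first.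
  apply: uniq_perm; rewrite ?filter_uniq ?iota_uniq ?fset_uniq // => i.
  rewrite mem_filter mem_index_iota.
  case: (boolP (i \in finsupp d)) => //=; rewrite mem_finsupp => di.
  rewrite ltnS lt0n; case: eqP => [i0|_] /=; first by rewrite i0 d0 in di.
  by case: leqP => // /dn di0; rewrite di0 in di.
rewrite big_filter big_mkcond /=; apply: eq_bigr => i _.
by case: (finsuppP d i) => // di; rewrite Fd // fsfun_dflt.
Qed.

Definition partial_value (d : nat -> nat) n := \sum_(1 <= i < n.+1) d i * u i.

Lemma partial_valueS d n :
  partial_value d n.+1 = partial_value d n + d n.+1 * u n.+1.
Proof. by rewrite /partial_value big_nat_recr. Qed.

Lemma represents_value (d : digit_seq) N n : represents d N ->
  (forall i, n < i -> d i = 0) -> N = partial_value d n.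
Proof.
case=> d0 _ _ -> dn; apply: (sum_finsupp d0 dn) => i ->.
by rewrite mul0n.
Qed.

(* [separated_below true d n] says that the digits 1..n of [d] may be followed
   by a digit 2 at position [n.+1]; [separated_below false] is no constraint. *)
Definition separated_below (c : bool) (d : nat -> nat) n :=
  c -> forall j, 0 < j <= n -> d j = 2 -> exists2 l, j < l <= n & d l = 0.

Lemma separated_below_false d n : separated_below false d n.
Proof. by []. Qed.

Lemma partial_value_lt (d : nat -> nat) (c : bool) n :
  (forall i, d i <= 2) -> separated_twos d -> separated_below c d n ->
  partial_value d n + c * u n < u n.+1.
Proof.
move=> d2 sd; elim: n c => [|n IHn] c cn.
  by rewrite /partial_value big_geq // muln0.
rewrite partial_valueS; have := uSS n; have := u_lt n.
have := d2 n.+1; case E: (d n.+1) => [|[|[|//]]] _.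
- by have := IHn false (@separated_below_false d n); case: c {cn}; lia.
- have cn' : separated_below c d n.
    move=> ct j /andP[j0 jn] dj.
    have [|l /andP[jl ln] dl] := cn ct j _ dj; first by rewrite j0 leqW.
    exists l => //; rewrite jl /=; move: ln; rewrite leq_eqVlt => /orP[/eqP le|//].
    by rewrite le E in dl.
  by have := IHn c cn'; case: c {cn cn'}; lia.
- have cn' : separated_below true d n.
    move=> _ j /andP[j0 jn] dj.
    by have [] := sd j n.+1 jn dj E => l jl dl; exists l.
  have := IHn true cn'; case: c cn => [cn|_]; last by lia.
  have [|l] := cn isT n.+1 _ E; first by rewrite leqnn.
  by case/andP=> /leq_trans h /h; rewrite ltnn.
Qed.

Lemma partial_value_inj (d e : nat -> nat) n :
  (forall i, d i <= 2) -> separated_twos d ->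
  (forall i, e i <= 2) -> separated_twos e ->
  partial_value d n = partial_value e n -> forall i, 0 < i <= n -> d i = e i.
Proof.
move=> d2 sd e2 se; elim: n => [|n IHn]; first by move=> _ [|i].
rewrite !partial_valueS => eq_de.
have := @partial_value_lt d false n d2 sd (@separated_below_false d n).
have := @partial_value_lt e false n e2 se (@separated_below_false e n).
rewrite !addn0 => ve vd.
have de : d n.+1 = e n.+1 by nia.
rewrite de in eq_de => i /andP[i0]; rewrite leq_eqVlt => /orP[/eqP->//|ilt].
by apply: IHn; [lia | rewrite i0].
Qed.

Lemma represents_uniq N (d e : digit_seq) :
  represents d N -> represents e N -> d = e.
Proof.
move=> rd re; pose n := \max_(i <- finsupp d ++ finsupp e) i.
have supp (g : digit_seq) : {subset finsupp g <= finsupp d ++ finsupp e} ->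
    forall i, n < i -> g i = 0.
  move=> sub i ni; apply: fsfun_dflt; apply: contraL ni => /sub ig.
  by rewrite -leqNgt; apply: (@leq_bigmax_seq _ _ predT id).
have dn : forall i, n < i -> d i = 0.
  by apply: supp => i; rewrite mem_cat => ->.
have en : forall i, n < i -> e i = 0.
  by apply: supp => i; rewrite mem_cat orbC => ->.
apply/fsfunP => i; case: (posnP i) => [->|i0].
  by rewrite (represents0 rd) (represents0 re).
case: (leqP i n) => [ilen|nlti]; last by rewrite dn ?en.
apply: (@partial_value_inj d e n); rewrite ?i0 //.
- exact: represents_le2 rd.
- exact: represents_sep rd.
- exact: represents_le2 re.
- exact: represents_sep re.
- by rewrite -(represents_value rd dn) -(represents_value re en).
Qed.

Lemma represents_exists_aux n (c : bool) N : N + c * u n < u n.+1 ->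
  {d : nat -> nat | [/\ forall i, (i == 0) || (n < i) -> d i = 0,
     forall i, d i <= 2, separated_twos d, separated_below c d n
     & N = partial_value d n]}.
Proof.
elim: n c N => [|n IHn] c N.
  rewrite muln0 addn0 ltnS leqn0 => /eqP->; exists (fun=> 0); split=> //.
  by rewrite /partial_value big_geq.
move=> NltS; have uS := uSS n; have ul := u_lt n.
pose q := if N < u n.+1 then 0 else if N < 2 * u n.+1 then 1 else 2.
pose c' := if q is 1 then c else q == 2.
have qc : c -> q <= 1.
  rewrite /q => ct; rewrite ct mul1n in NltS.
  by case: ltnP => // _; case: ltnP => //; lia.
have qN : q * u n.+1 <= N.
  by rewrite /q; case: ltnP => // ?; case: ltnP => //; lia.
have bnd : N - q * u n.+1 + c' * u n < u n.+1.
  rewrite /c' /q; case: (ltnP N) => ?; first by rewrite /=; lia.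
  case: (ltnP N) => ?; first by move: NltS; case: (c); lia.
  by move: NltS; case: (c) => /=; lia.
have q2 : q <= 2 by rewrite /q; case: ifP => // _; case: ifP.
have [d [d0 d2 sd cd Nd]] := IHn _ _ bnd.
exists (fun i => if i == n.+1 then q else d i); split.
- by move=> i hi; case: (i =P n.+1) => ?; [lia | apply: d0; lia].
- by move=> i; case: ifP.
- move=> i j ij; case: eqP => [ei qi|_ di]; case: eqP => [jn qj|_ dj].
  + by lia.
  + have dj0 : d j = 0 by apply: d0; lia.
    by rewrite dj0 in dj.
  + have c't : c' by rewrite /c' qj.
    have i0 : 0 < i by rewrite lt0n; apply/eqP => i0; rewrite d0 ?i0 in di.
    have [|l il dl] := cd c't i _ di; first by lia.
    by exists l; [lia | rewrite ifF //; apply/eqP; lia].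
  + have [l il dl] := sd i j ij di dj; exists l => //; case: eqP => // ln.
    have dj0 : d j = 0 by apply: d0; lia.
    by rewrite dj0 in dj.
- move=> ct j /andP[j0 jn]; case: eqP => [_ q2'|jn' dj].
    by have := qc ct; rewrite q2'.
  case q01 : q (qc ct) => [|[|//]] _.
    by exists n.+1; [lia | rewrite eqxx].
  have c't : c' by rewrite /c' q01.
  have [|l il dl] := cd c't j _ dj; first by lia.
  by exists l; [lia | rewrite ifF //; apply/eqP; lia].
- rewrite partial_valueS eqxx -[LHS](subnK qN) Nd; congr (_ + _).
  by apply: eq_big_nat => i /andP[_ ilt]; rewrite ifF //; apply/eqP; lia.
Qed.

Lemma represents_exists N : {d : digit_seq | represents d N}.
Proof.
have uN : N + false * u N < u N.+1.
  rewrite addn0; elim: N => // N IHN; exact: leq_ltn_trans IHN (u_lt _).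
have [d [d0 d2 sd _ Nd]] := represents_exists_aux uN.
pose e : digit_seq := [fsfun i in [fset i | i in iota 0 N.+1]%fset => d i | 0].
have eE : e =1 d.
  move=> i; rewrite fsfunE !inE mem_iota /= ltnS.
  by case: ifP => /= iN; last by rewrite d0 //; move: iN; lia.
exists e; split=> [|i|i j|].
- by rewrite eE d0.
- by rewrite eE.
- rewrite !eE => ij di dj; have [l il dl] := sd i j ij di dj.
  by exists l; rewrite ?eE.
- rewrite Nd (@sum_finsupp nat e N); first by apply: eq_bigr => i _; rewrite eE.
  + by rewrite eE d0.
  + by move=> i Ni; rewrite eE d0 // Ni orbT.
  + by move=> i ->; rewrite mul0n.
Qed.

(* [represents_exists] is opaque: [digits a] is accessible only through
   [digitsP] and [digitsE]. *)
Definition digits (a : nat) : digit_seq := sval (represents_exists a).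

Lemma digitsP a : represents (digits a) a.
Proof. exact: proj2_sig (represents_exists a). Qed.

Lemma digitsE a (d : digit_seq) : represents d a -> digits a = d.
Proof. exact/represents_uniq/digitsP. Qed.

Definition f (a : nat) : rat :=
  (\sum_(i <- finsupp (digits a)) (digits a i)%:R / (u i)%:R)%R.

(* Main.v *)
(** Write [x], [y], [z] for the inverses of [u l], [u l.+1], [u l.+2]. The
    identity [u l * u l.+2 = u l.+1 ^ 2 - 1] gives [3 y < x + z], and this makes
    a downward induction on [l] show that the digits beyond position [l]
    contribute less than [x] to [f], and less than [x - y] when a digit 2 at or
    before [l] still awaits its separating 0. So the first differing digit
    decides the comparison. *)
Require Import Defs.
From mathcomp Require Import all_boot all_order all_algebra.
From mathcomp Require Import finmap zify lra.

Import Order.TTheory GRing.Theory Num.Theory.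

(** Catalan's identity with shift 2 for Fibonacci numbers, in additive form since subtraction on
    [nat] truncates. *)
Lemma u_cassini n : u n * u n.+2 + 1 = u n.+1 ^ 2.
Proof.
by elim: n => // n IHn; have := uSS n; have := uSS n.+1; nia.
Qed.

Section InverseU.

Local Open Scope ring_scope.

Let v n : rat := (u n)%:R^-1.

Lemma inv_u_gt0 n : (0 < n)%N -> 0 < v n.
Proof. by move=> n0; rewrite invr_gt0 ltr0n u_gt0. Qed.

Lemma inv_uS_le n : (0 < n)%N -> 2 * v n.+1 <= v n.
Proof.
case: n => // n _; rewrite ler_pdivrMr ?ltr0n ?u_gt0 //.
rewrite mulrC ler_pdivlMr ?ltr0n ?u_gt0 // -natrM ler_nat.
by have := uSS n; have := u_lt n; lia.
Qed.

(** Clearing denominators and applying [uSS] reduces this to [u n * u n.+2 < u n.+1 ^ 2], given by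
    [u_cassini]. *)
Lemma inv_u_convex n : (0 < n)%N -> 3 * v n.+1 < v n + v n.+2.
Proof.
move=> n0; have u0 := u_gt0 n0; have u1 := u_gt0 (ltn0Sn n).
have u2 := u_gt0 (ltn0Sn n.+1).
rewrite -[v n]mul1r -[v n.+2]mul1r addf_div ?pnatr_eq0 -?lt0n // !mul1r.
rewrite -!natrD -!natrM ltr_pdivrMr ?ltr0n // mulrAC ltr_pdivlMr ?ltr0n ?muln_gt0 ?u0 //.
rewrite -!natrM ltr_nat.
by have := uSS n; have := u_cassini n; nia.
Qed.

(* [c] records that some digit 2 at or before position [l] is not yet followed
   by a 0. *)
Lemma tail_lt (d : nat -> nat) (c : bool) k l :
  (forall i, d i <= 2)%N -> separated_twos d -> (0 < l)%N ->
  (c -> forall j, (l < j)%N -> d j = 2%N -> exists2 m, (l < m < j)%N & d m = 0%N) ->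
  \sum_(l.+1 <= i < l.+1 + k) (d i)%:R / (u i)%:R + c%:R * v l.+1 < v l.
Proof.
move=> d2 sd; elim: k c l => [|k IHk] c l l0 cl;
  have v0 := inv_u_gt0 _ l0; have v1 := inv_u_gt0 _ (ltn0Sn l);
  have le21 := inv_uS_le _ l0.
  by rewrite addn0 big_geq //; case: (c) => /=; lra.
have lt31 := inv_u_convex _ l0; have v2 := inv_u_gt0 _ (ltn0Sn l.+1).
rewrite big_ltn ?addnS ?ltnS ?leq_addr // -addSn -/(v l.+1).
have := d2 l.+1; case E: (d l.+1) => [|[|[|//]]] _.
(* Digit 0 is the awaited separator: the rest is bounded with [c] false, and [2 * v l.+1 <= v l]
   suffices. *)
- have := IHk false l.+1 isT; rewrite mul0r addr0 => /(_ ltac:(by [])).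
  by case: (c) => /=; lra.
(* Digit 1 passes [c] on; if [c] holds, the total is below [3 * v l.+1 - v l.+2]. *)
- have /(IHk c l.+1 isT) : c -> forall j, (l.+1 < j)%N -> d j = 2%N ->
      exists2 m, (l.+1 < m < j)%N & d m = 0%N.
    move=> ct j lj dj; have [|m /andP[lm mj] dm] := cl ct j _ dj; first exact: ltnW.
    exists m => //; rewrite mj andbT ltn_neqAle lm andbT.
    by apply/eqP => lm'; rewrite lm' dm in E.
  by case: (c) => /=; lra.
(* Digit 2 awaits a 0; were [c] true, [cl] would put a 0 strictly between [l] and [l.+1]. *)
- have /(IHk true l.+1 isT) : true -> forall j, (l.+1 < j)%N -> d j = 2%N ->
      exists2 m, (l.+1 < m < j)%N & d m = 0%N by move=> _ j lj; apply: sd.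
  case: c cl => [cl|_] /=; last by lra.
  by have [//|//|m] := cl isT l.+1; lia.
Qed.

Lemma f_sum a n : (forall i, (n < i)%N -> digits a i = 0%N) ->
  f a = \sum_(1 <= i < n.+1) (digits a i)%:R / (u i)%:R.
Proof.
move=> an; apply: sum_finsupp => // [|i ->]; last by rewrite mul0r.
exact: represents0 (digitsP a).
Qed.

Lemma f_lt a b l : (0 < l)%N ->
  (forall i, (0 < i)%N -> (i < l)%N -> digits a i = digits b i) ->
  (digits a l < digits b l)%N -> f a < f b.
Proof.
move=> l0 min_l lt_l.
(* The cutoff [l + k] bounds both supports and leaves [k] positions after [l], as in [tail_lt]. *)
pose k := (\max_(i <- finsupp (digits a) ++ finsupp (digits b)) i)%N.
have supp c i : {subset finsupp (digits c) <=
    finsupp (digits a) ++ finsupp (digits b)} -> (l + k < i)%N -> digits c i = 0%N.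
  move=> sub ki; apply: fsfun_dflt; apply: contraL ki => /sub ic.
  rewrite -leqNgt; apply: leq_trans (leq_addl _ _).
  exact: (@leq_bigmax_seq _ _ predT id).
rewrite (f_sum a (l + k)) => [|i]; last by apply: supp => j; rewrite mem_cat => ->.
rewrite (f_sum b (l + k)) => [|i]; last first.
  by apply: supp => j; rewrite mem_cat orbC => ->.
have l_le : (l < (l + k).+1)%N by rewrite ltnS leq_addr.
rewrite !(@big_cat_nat _ _ _ l 1 (l + k).+1) //=; try exact: ltnW.
rewrite (eq_big_nat _ _ (F2 := fun i => (digits b i)%:R / (u i)%:R)); last first.
  by move=> i /andP[i0 il]; rewrite min_l.
rewrite ltrD2l !(big_ltn l_le) -addSn.
have := @tail_lt (digits a) false k l (represents_le2 (digitsP a))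
  (represents_sep (digitsP a)) l0 ltac:(by []).
rewrite mul0r addr0 -/(v l) => tail_a.
have tail_b : 0 <= \sum_(l.+1 <= i < l.+1 + k) (digits b i)%:R / (u i)%:R :> rat.
  by apply: sumr_ge0 => i _; rewrite divr_ge0 ?ler0n.
(* Digits are integers, so [b] leads at [l] by at least [v l], more than the whole tail of [a]. *)
have head : (digits a l)%:R * v l + v l <= (digits b l)%:R * v l.
  rewrite -[X in _ + X]mul1r -mulrDl natr1.
  by rewrite ler_wpM2r ?ler_nat // ltW // inv_u_gt0.
by apply: lt_le_trans (ler_wpDr tail_b head); rewrite ltrD2l.
Qed.

End InverseU.

Theorem theorem14 (a b l : nat) (neq_ab : a <> b) (l_ge1 : 1 <= l)
    (neq_l : digits a l <> digits b l)
    (min_l : forall i : nat, 1 <= i -> i < l -> digits a i = digits b i) :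
  (f a < f b)%R <-> digits a l < digits b l.
Proof.
split=> [lt_f|]; last exact: f_lt.
have /eqP := neq_l; rewrite neq_ltn => /orP[//|lt_l].
have /(lt_trans lt_f) : (f b < f a)%R.
  by apply: f_lt lt_l => // i i0 il; rewrite min_l.
by rewrite ltxx.
Qed.
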